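(* Let $k,a,b,c,r$ be integers with $k\geq c>b>a\geq 1$ and $r\geq 1$. Let $\mathcal{R}_{a,b,c,k}$ be the set of partitions $\pi=(\pi_1,\ldots,\pi_m)$ such that every part is congruent to $a$, $b$ or $c$ modulo $k$, the parts congruent to $c$ modulo $k$ are distinct, and for $1\leq i<m$, if $\pi_i\equiv a\pmod k$ then $\pi_{i+1}$ is congruent to $a$ or $c$ modulo $k$. Let $\mathcal{R}_{a,b,c,k,r}$ be the set of partitions in $\mathcal{R}_{a,b,c,k}$ for which there is no index $i$ with $\pi_i,\ldots,\pi_{i+r-1}$ all congruent to $b$ modulo $k$. Then $\mathcal{R}_{a,b,c,k}$ and $\mathcal{R}_{a,b,c,k,r}$ are separable integer partition classes with modulus $k$.
   Context: Partitions are non-increasing finite sequences of positive integers. For a positive integer $k$, a separable integer partition class $\mathcal{P}$ with modulus $k$ is a set of partitions for which there is a subset $\mathcal{B}\subset\mathcal{P}$ (the basis) such that for each $m\geq 1$ the number of partitions in $\mathcal{B}$ with $m$ parts is finite, every partition in $\mathcal{P}$ with $m$ parts is uniquely of the form $(b_1+\pi_1,\ldots,b_m+\pi_m)$ where $(b_1,\ldots,b_m)\in\mathcal{B}$ and $(\pi_1,\ldots,\pi_m)$ is a non-increasing sequence of nonnegative integers each divisible by $k$, and all partitions of this form lie in $\mathcal{P}$. *)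

(* Defs.v *)
From mathcomp Require Import all_boot.
From mathcomp Require Import boolp classical_sets cardinality.

Set Implicit Arguments.
Unset Strict Implicit.
Unset Printing Implicit Defensive.

Local Open Scope classical_set_scope.

Definition is_partition (s : seq nat) : bool :=
  sorted geq s && all (leq 1) s.

Definition kmultiples (k : nat) (p : seq nat) : bool :=
  sorted geq p && all (dvdn k) p.

(* Only meaningful for sequences of equal length: zip truncates. *)
Definition addseq (s t : seq nat) : seq nat :=
  [seq x.1 + x.2 | x <- zip s t].

Definition sip_basis (k : nat) (P B : set (seq nat)) : Prop :=
  B `<=` P /\
  forall m : nat, 1 <= m ->
    [/\ finite_set [set b | B b /\ size b = m],
        forall s, P s -> size s = m ->
          exists! bp : seq nat * seq nat,
            [/\ B bp.1, size bp.1 = m, kmultiples k bp.2, size bp.2 = m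
              & s = addseq bp.1 bp.2]
      & forall b p, B b -> size b = m -> kmultiples k p -> size p = m ->
          P (addseq b p)].

Definition sip_class (k : nat) (P : set (seq nat)) : Prop :=
  P `<=` [set s | is_partition s] /\ exists B : set (seq nat), sip_basis k P B.

Definition Rabck (a b c k : nat) : set (seq nat) :=
  [set s | [/\ is_partition s,
    forall x, x \in s ->
      [\/ x = a %[mod k], x = b %[mod k] | x = c %[mod k]],
    uniq [seq x <- s | x == c %[mod k]]
  & forall i, i.+1 < size s ->
      nth 0 s i = a %[mod k] ->
      nth 0 s i.+1 = a %[mod k] \/ nth 0 s i.+1 = c %[mod k]]].

Definition Rabckr (a b c k r : nat) : set (seq nat) :=
  [set s | Rabck a b c k s /\
    ~ exists i, i + r <= size s /\
        forall j, j < r -> nth 0 s (i + j) = b %[mod k]].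

(* Main.v *)
Require Import Defs.
From mathcomp Require Import all_boot.
From mathcomp Require Import boolp classical_sets cardinality zify.

Set Implicit Arguments.
Unset Strict Implicit.
Unset Printing Implicit Defensive.

(** Both classes consist of the sequences that satisfy minimal gap conditions
    between consecutive parts (gap 1 between two parts congruent to c, gap 0
    otherwise, smallest part at least 1), where the required gap depends only on
    the residues of the two parts, and whose sequence of residues is allowed.
    For each allowed residue sequence there is exactly one sequence all of whose
    gaps are as small as the residues permit; these tight sequences form a basis. *)

Local Open Scope classical_set_scope.

Section Gapped.

Variables (k : nat) (d : nat -> nat -> nat).

(** The value 1 on the empty tail makes the smallest part positive. Once [d] depends only on
    residues mod [k], so does the bound as a function of [x]. *)
Definition lower_bound x s := if s is y :: _ then y + d x y else 1.

Fixpoint gapped s :=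
  if s is x :: s' then (lower_bound x s' <= x) && gapped s' else true.

(** Together with [gapped], this confines [x] to a window of [k] consecutive integers, which meets
    each residue class exactly once. *)
Fixpoint tight s :=
  if s is x :: s' then (x < lower_bound x s' + k) && tight s' else true.

Hypothesis k_gt0 : 0 < k.
Hypothesis d_mod : forall x y, d (x %% k) (y %% k) = d x y.

Lemma addseq_cons x s y t : addseq (x :: s) (y :: t) = x + y :: addseq s t.
Proof. by []. Qed.

Lemma kmultiples_cons x s :
  kmultiples k (x :: s) = [&& k %| x, head 0 s <= x & kmultiples k s].
Proof.
rewrite /kmultiples; case: s => [|y s] /=; first by rewrite !andbT.
by case: (k %| x); case: (y <= x); rewrite /= ?andbF.
Qed.

Lemma dvdn_head s : kmultiples k s -> k %| head 0 s.
Proof. by case: s => [|y s] //; rewrite kmultiples_cons => /andP[]. Qed.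

Lemma eq_gap x y u v : x = u %[mod k] -> y = v %[mod k] -> d x y = d u v.
Proof. by move=> xu yv; rewrite -d_mod xu yv d_mod. Qed.

Lemma eq_lower_bound x y s : x = y %[mod k] -> lower_bound x s = lower_bound y s.
Proof. by case: s => [|z s] //= xy; rewrite (eq_gap xy (erefl (z %% k))). Qed.

Lemma modn_addr_dvd x y : k %| y -> x + y = x %[mod k].
Proof. by move=> /eqP y0; rewrite -modnDmr y0 addn0. Qed.

(** Adding multiples of [k] changes no residue, hence no gap, so the bound only moves with the
    leading summand. For empty sequences the default 0 of [head] keeps it at 1. *)
Lemma lower_bound_addseq x u b p : x = u %[mod k] -> size b = size p ->
  kmultiples k p ->
  lower_bound x (addseq b p) = lower_bound u b + head 0 p.
Proof.
case: b p => [|y b] [|q p] //= xu _; rewrite kmultiples_cons => /and3P[kq _ _].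
by rewrite (eq_gap xu (modn_addr_dvd y kq)) addnAC.
Qed.

Lemma addseq_residues b p : size b = size p -> kmultiples k p ->
  [seq x %% k | x <- addseq b p] = [seq x %% k | x <- b].
Proof.
elim: b p => [|y b IH] [|q p] //= [sz]; rewrite kmultiples_cons => /and3P[kq _ kp].
by rewrite (modn_addr_dvd y kq); congr cons; exact: IH.
Qed.

Lemma gapped_addseq b p : size b = size p -> kmultiples k p ->
  gapped b -> gapped (addseq b p).
Proof.
elim: b p => [|y b IH] [|q p] //= [sz].
rewrite kmultiples_cons => /and3P[kq hq kp] /andP[hy gb].
rewrite (lower_bound_addseq (modn_addr_dvd y kq) sz kp) (IH _ sz kp gb) andbT.
exact: leq_add.
Qed.

(** Built from the smallest part upwards: the excess of each part over its bound is divided by [k];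
    the remainder stays in [b], the multiple of [k] goes to [p]. *)
Lemma gapped_decomposition s : gapped s -> exists b p,
  [/\ gapped b && tight b, size b = size s, kmultiples k p, size p = size s
    & s = addseq b p].
Proof.
elim: s => [|x s IH] /=; first by exists [::], [::].
case/andP=> hx /IH [b [p [/andP[gb tb] sb kp sp es]]].
have szbp : size b = size p by rewrite sb sp.
move: hx; rewrite es (lower_bound_addseq (erefl (x %% k)) szbp kp) => hx.
set l := lower_bound x b in hx; set e := x - (l + head 0 p).
have xE : l + e %% k + (head 0 p + e %/ k * k) = x.
  by have := divn_eq e k; rewrite /e; lia.
have kq : k %| head 0 p + e %/ k * k by rewrite dvdn_add ?dvdn_head ?dvdn_mull.
(* The new head of [b] is congruent to [x], so it faces the same bound. *)
have lE : lower_bound (l + e %% k) b = l.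
  by apply: eq_lower_bound; rewrite -(modn_addr_dvd _ kq) xE.
exists (l + e %% k :: b), (head 0 p + e %/ k * k :: p); split => /=.
- by rewrite lE leq_addr gb tb ltn_add2l ltn_pmod.
- by rewrite -es sb.
- by rewrite kmultiples_cons kq leq_addr kp.
- by rewrite -es sp.
- by rewrite addseq_cons xE.
Qed.

Lemma eq_modn_window l x y : l <= x < l + k -> l <= y < l + k ->
  x = y %[mod k] -> x = y.
Proof.
move=> /andP[lx xl] /andP[ly yl].
rewrite -(subnKC lx) -(subnKC ly) => /eqP.
by rewrite eqn_modDl !modn_small; [move=> /eqP -> | lia | lia].
Qed.

(** Once the tails agree, congruent heads lie in the same window of length [k] and therefore
    coincide. *)
Lemma tight_residues_inj b b' : gapped b && tight b -> gapped b' && tight b' ->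
  [seq x %% k | x <- b] = [seq x %% k | x <- b'] -> b = b'.
Proof.
elim: b b' => [|x b IH] [|y b'] //= /andP[/andP[lx gb] /andP[xl tb]].
move=> /andP[/andP[ly gb'] /andP[yl tb']] [xy bb'].
have ebb : b = b' by apply: IH; rewrite ?gb ?gb'.
rewrite -{}ebb in ly yl *.
rewrite -(eq_lower_bound b xy) in ly yl.
by congr cons; apply: (eq_modn_window (l := lower_bound x b)); rewrite ?lx ?ly.
Qed.

Lemma addseq_inj b p p' : size b = size p -> size b = size p' ->
  addseq b p = addseq b p' -> p = p'.
Proof.
elim: b p p' => [|y b IH] [|q p] [|q' p'] //= [sp] [sp'].
rewrite !addseq_cons => -[/addnI -> /IH -> //].
Qed.

Lemma finite_bounded_seqs N m :
  finite_set [set s : seq nat | all (fun x => x < N) s /\ size s = m].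
Proof.
apply: (@sub_finite_set _ _
  ((fun t : m.-tuple 'I_N => map val t) @` setT)); last first.
  by apply: finite_image; exact: finite_finset.
move=> s [/allP sN /eqP sm].
have sN' : map val (pmap insub s : seq 'I_N) = s.
  rewrite -[RHS]filter_predT (pmap_filter (@insubK _ _ _)).
  by apply: eq_in_filter => x /sN xN /=; rewrite insubT.
have szm : size (pmap insub s : seq 'I_N) == m.
  by rewrite -(size_map val) sN'.
by exists (Tuple szm).
Qed.

Variable D : nat.
Hypothesis d_le : forall x y, d x y <= D.

(** The last part is at most [k], and every other part exceeds the next one by less than [k + D]. *)
Lemma tight_bounded b : gapped b -> tight b ->
  all (fun x => x < (size b) * (k + D) + 2) b.
Proof.
elim: b => [|x b IH] //= /andP[lx gb] /andP[xl tb].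
have {}IH := IH gb tb; apply/andP; split; last first.
  by apply: sub_all IH => y; lia.
case: b IH {lx gb tb} xl => [|y b] /=; first by lia.
by have := d_le x y => + /andP[] + _; lia.
Qed.

Lemma gapped_partition s : gapped s -> is_partition s.
Proof.
rewrite /is_partition; elim: s => [|x [|y s] IH] //=.
move=> /andP[yx /IH /= /andP[-> /andP[y0 ->]]].
by rewrite y0 !andbT; lia.
Qed.

(** Among gapped sequences, membership in [P] is decided by residues, which are unaffected by
    removing or adding multiples of [k]. *)
Lemma sip_class_gapped (P : set (seq nat)) : P `<=` [set s | gapped s] ->
  (forall s t, P s -> gapped t ->
     [seq x %% k | x <- s] = [seq x %% k | x <- t] -> P t) ->
  sip_class k P.
Proof.
move=> Pgap Pres; split; first by move=> s /Pgap /gapped_partition.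
exists [set b | P b /\ tight b]; split; first by move=> b [].
move=> m _; split.
- apply: sub_finite_set (finite_bounded_seqs (m * (k + D) + 2) m).
  by move=> b [[/Pgap gb tb] <-]; split => //; exact: tight_bounded.
- move=> s Ps sm; have [b [p [gtb sb kp sp es]]] := gapped_decomposition (Pgap _ Ps).
  have szbp : size b = size p by rewrite sb sp.
  have rs : [seq x %% k | x <- s] = [seq x %% k | x <- b].
    by rewrite es addseq_residues.
  have [gb tb] := andP gtb.
  exists (b, p); split => /=.
    by split => //; rewrite ?sb ?sp //; split => //; exact: Pres Ps gb rs.
  (* The residues of [s] force the tight sequence [b']; cancellation then forces [p']. *)
  move=> [b' p'] /= [[Pb' tb'] sb' kp' sp' es'].
  have szbp' : size b' = size p' by rewrite sb' sp'.
  have ebb : b = b'.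
    apply: tight_residues_inj => //; first by rewrite tb' andbT; exact: Pgap.
    by rewrite -rs es' addseq_residues.
  rewrite -{}ebb in szbp' es' *; congr pair.
  by apply: (addseq_inj szbp szbp'); rewrite -es.
- move=> b p [Pb tb] sb kp sp; have szbp : size b = size p by rewrite sb sp.
  apply: (Pres _ _ Pb); last by rewrite addseq_residues.
  by apply: gapped_addseq => //; exact: Pgap.
Qed.

End Gapped.

Definition distinct_gap c k x y : nat := (x == c %[mod k]) && (y == c %[mod k]).

(** In a sorted sequence equal parts are adjacent, so a condition on consecutive parts already
    excludes every repetition. *)
Lemma gapped_distinctE c k s : gapped (distinct_gap c k) s =
  is_partition s && uniq [seq x <- s | x == c %[mod k]].
Proof.
elim: s => [|x s IH] //=; rewrite {}IH /is_partition.
case: s => [|y s]; first by rewrite /=; case: ifP; rewrite /= !andbT.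
set f := filter _ (y :: s).
have -> : sorted geq (x :: y :: s) = (y <= x) && sorted geq (y :: s) by [].
have -> : all (leq 1) (x :: y :: s) = (0 < x) && all (leq 1) (y :: s) by [].
have [sy|] := boolP (sorted geq (y :: s)); last by rewrite ?andbF.
have [py|] := boolP (all (leq 1) (y :: s)); last by rewrite ?andbF.
rewrite /= !andbT.
have y0 : 0 < y by case/andP: py.
have ley z : z \in y :: s -> z <= y.
  have geq_trans : transitive geq by move=> u v w /= uv /leq_trans; exact.
  by rewrite inE => /predU1P[-> //|]; exact: (allP (order_path_min geq_trans sy)).
rewrite /distinct_gap; have [xc|xc] /= := boolP (x == c %[mod k]); last first.
  by rewrite addn0; case: (leqP y x) => //= yx; rewrite (leq_trans y0 yx).
rewrite [RHS]andbA; congr (_ && _).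
rewrite mem_filter xc /=; apply/idP/idP.
  (* A later copy of [x] would be at most [y], forcing [x = y] against the gap 1. *)
  move=> yx; have -> : y <= x by lia.
  have -> /= : 0 < x by lia.
  apply/negP => /ley xy; have exy : x = y by lia.
  by move: yx; rewrite -exy xc; lia.
move=> /andP[/andP[yx _]]; rewrite inE negb_or => /andP[nxy _].
by case: (y == c %[mod k]); lia.
Qed.

Lemma nth_eq_mod k s t : [seq x %% k | x <- s] = [seq x %% k | x <- t] ->
  size s = size t /\ forall i, nth 0 s i = nth 0 t i %[mod k].
Proof.
move=> e; have sz : size s = size t by rewrite -(size_map (modn^~ k)) e size_map.
(* Past the common length both entries are the default 0. *)
split=> // i; case: (ltnP i (size s)) => hi; last by rewrite !nth_default // -sz.
by rewrite -(nth_map 0 0 (modn^~ k)) // e (nth_map 0) // -sz.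
Qed.

Lemma Rabck_gapped a b c k :
  Rabck a b c k `<=` [set s | gapped (distinct_gap c k) s].
Proof. by move=> s [ps _ us _] /=; rewrite gapped_distinctE ps. Qed.

(** Order, positivity and distinctness come from the gaps of [t]; the other two conditions see only
    residues. *)
Lemma Rabck_residues a b c k s t : Rabck a b c k s ->
  gapped (distinct_gap c k) t ->
  [seq x %% k | x <- s] = [seq x %% k | x <- t] -> Rabck a b c k t.
Proof.
move=> [_ abc _ nab]; rewrite gapped_distinctE => /andP[pt ut] /nth_eq_mod[sz e].
split=> //.
  move=> x xt; rewrite -(nth_index 0 xt) -e; apply: abc.
  by rewrite mem_nth // sz index_mem.
by move=> i; rewrite -sz -!e; exact: nab.
Qed.

Theorem theorem4p2 (k a b c r : nat) (hck : c <= k) (hbc : b < c)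
    (hab : a < b) (ha : 1 <= a) (hr : 1 <= r) :
  sip_class k (Rabck a b c k) /\ sip_class k (Rabckr a b c k r).
Proof.
have k0 : 0 < k by lia.
have dmod x y : distinct_gap c k (x %% k) (y %% k) = distinct_gap c k x y.
  by rewrite /distinct_gap !modn_mod.
have dle x y : distinct_gap c k x y <= 1 by exact: leq_b1.
split; apply: (sip_class_gapped k0 dmod dle).
- exact: Rabck_gapped.
- exact: Rabck_residues.
- by move=> s [/Rabck_gapped].
- move=> s t [Rs nb] gt st; split; first exact: Rabck_residues Rs gt st.
  have [sz e] := nth_eq_mod st.
  (* A run of [r] parts congruent to [b] in [t] would occur at the same place in [s]. *)
  move=> [i [ir hb]]; apply: nb; exists i; split; first by rewrite sz.
  by move=> j jr; rewrite e; exact: hb.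
Qed.
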